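(* Let $\gamma\in[0,1)$ and consider the function $$C(L_f,L_r,L_\pi):=\frac{\gamma L_r(1+L_\pi)}{(1-\gamma)(1-\gamma L_f(1+L_\pi))}$$ on the set $D:=\{(L_f,L_r,L_\pi)\in[0,\infty)^3:\gamma L_f(1+L_\pi)<1\}$. Then $C$ is non-decreasing in each of $L_f$, $L_r$ and $L_\pi$ on $D$. Hence, for fixed $\varepsilon_{\mathrm{dyn}},\varepsilon_{\mathrm{rew}}\ge 0$, lowering any of $L_f,L_r,L_\pi$ (keeping them nonnegative) does not increase the quantity $$\frac{1}{1-\gamma}\,\varepsilon_{\mathrm{rew}}+C(L_f,L_r,L_\pi)\,\varepsilon_{\mathrm{dyn}}.$$
   Context: The displayed quantity is an upper bound on the gap in discounted return of an $L_\pi$-Lipschitz policy between a true Markov decision process with $L_f$-Lipschitz dynamics and $L_r$-Lipschitz reward (discount $\gamma$) and a learned Markov decision process whose worst-case dynamics and reward errors are $\varepsilon_{\mathrm{dyn}}$ and $\varepsilon_{\mathrm{rew}}$. ''Tightening the bound'' means (weakly) decreasing this quantity. *)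

(* Defs.v *)
From Stdlib Require Import Reals.
Open Scope R_scope.

Definition lip_domain (gamma Lf Lr Lpi : R) : Prop :=
  0 <= Lf /\ 0 <= Lr /\ 0 <= Lpi /\ gamma * Lf * (1 + Lpi) < 1.

(* Meaningful only on [lip_domain gamma] with [0 <= gamma < 1], where the
   denominator is positive; elsewhere it takes a junk value. *)
Definition dyn_coef (gamma Lf Lr Lpi : R) : R :=
  (gamma * Lr * (1 + Lpi)) / ((1 - gamma) * (1 - gamma * Lf * (1 + Lpi))).

Definition return_gap_bound (gamma eps_dyn eps_rew Lf Lr Lpi : R) : R :=
  1 / (1 - gamma) * eps_rew + dyn_coef gamma Lf Lr Lpi * eps_dyn.

Definition nondecreasing_on (S : R -> Prop) (f : R -> R) : Prop :=
  forall x y : R, S x -> S y -> x <= y -> f x <= f y.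

(* Main.v *)
Require Import Defs.
From Stdlib Require Import Reals Lra.
Open Scope R_scope.

(** The product [gamma * L * (1 + Lpi)] of nonnegative factors grows with [L] and [Lpi]. With
    [L = Lr] it is the numerator of [dyn_coef]; with [L = Lf] it is what the denominator subtracts
    from 1. So raising the constants inside the domain raises the numerator and shrinks a positive
    denominator. [dyn_coef_le] proves this for all three constants jointly. *)

Lemma gain_le (gamma Lf Lpi Lf' Lpi' : R) :
  0 <= gamma -> 0 <= Lf' <= Lf -> 0 <= Lpi' <= Lpi ->
  gamma * Lf' * (1 + Lpi') <= gamma * Lf * (1 + Lpi).
Proof.
intros hg hf hp.
apply Rmult_le_compat; try lra.
- apply Rmult_le_pos; lra.
- apply Rmult_le_compat_l; lra.
Qed.

(** Ensures that lowering the constants never leaves the region where the bound is meaningful. *)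
Lemma lip_domain_downward (gamma Lf Lr Lpi Lf' Lr' Lpi' : R) :
  0 <= gamma -> lip_domain gamma Lf Lr Lpi ->
  0 <= Lf' <= Lf -> 0 <= Lr' <= Lr -> 0 <= Lpi' <= Lpi ->
  lip_domain gamma Lf' Lr' Lpi'.
Proof.
intros hg (_ & _ & _ & hD) hf hr hp.
repeat split; try lra.
apply Rle_lt_trans with (2 := hD).
now apply gain_le.
Qed.

Lemma dyn_coef_le (gamma Lf Lr Lpi Lf' Lr' Lpi' : R) :
  0 <= gamma < 1 -> lip_domain gamma Lf Lr Lpi ->
  0 <= Lf' <= Lf -> 0 <= Lr' <= Lr -> 0 <= Lpi' <= Lpi ->
  dyn_coef gamma Lf' Lr' Lpi' <= dyn_coef gamma Lf Lr Lpi.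
Proof.
intros hg (_ & _ & _ & hD) hf hr hp.
assert (hle : gamma * Lf' * (1 + Lpi') <= gamma * Lf * (1 + Lpi))
  by (apply gain_le; lra).
assert (hden : 0 < (1 - gamma) * (1 - gamma * Lf * (1 + Lpi)))
  by (apply Rmult_lt_0_compat; lra).
(* The smaller constants give the larger denominator, so its positivity follows from [hden]. *)
assert (hden' : (1 - gamma) * (1 - gamma * Lf * (1 + Lpi))
                <= (1 - gamma) * (1 - gamma * Lf' * (1 + Lpi')))
  by (apply Rmult_le_compat_l; lra).
unfold dyn_coef, Rdiv.
apply Rmult_le_compat.
- repeat apply Rmult_le_pos; lra.
- apply Rlt_le, Rinv_0_lt_compat; lra.
(* Numerators: [gain_le] with [Lr] in the role of [Lf]. *)
- apply gain_le; lra.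
- now apply Rinv_le_contravar.
Qed.

Theorem corollary1 (gamma : R) (hgamma : 0 <= gamma < 1) :
  (forall Lr Lpi : R,
     nondecreasing_on (fun Lf => lip_domain gamma Lf Lr Lpi)
                      (fun Lf => dyn_coef gamma Lf Lr Lpi)) /\
  (forall Lf Lpi : R,
     nondecreasing_on (fun Lr => lip_domain gamma Lf Lr Lpi)
                      (fun Lr => dyn_coef gamma Lf Lr Lpi)) /\
  (forall Lf Lr : R,
     nondecreasing_on (fun Lpi => lip_domain gamma Lf Lr Lpi)
                      (fun Lpi => dyn_coef gamma Lf Lr Lpi)) /\
  (forall eps_dyn eps_rew : R, 0 <= eps_dyn -> 0 <= eps_rew ->
   forall Lf Lr Lpi Lf' Lr' Lpi' : R,
     lip_domain gamma Lf Lr Lpi ->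
     0 <= Lf' <= Lf -> 0 <= Lr' <= Lr -> 0 <= Lpi' <= Lpi ->
     lip_domain gamma Lf' Lr' Lpi' /\
     return_gap_bound gamma eps_dyn eps_rew Lf' Lr' Lpi'
       <= return_gap_bound gamma eps_dyn eps_rew Lf Lr Lpi).
Proof.
split; [| split; [| split]].
(* Joint monotonicity with the other two constants kept equal; the domain condition is taken at the
   larger point [y]. *)
- intros Lr Lpi x y (hx & hr & hp & _) hy hxy.
  apply dyn_coef_le; trivial; lra.
- intros Lf Lpi x y (hf & hx & hp & _) hy hxy.
  apply dyn_coef_le; trivial; lra.
- intros Lf Lr x y (hf & hr & hx & _) hy hxy.
  apply dyn_coef_le; trivial; lra.
- intros eps_dyn eps_rew hdyn _ Lf Lr Lpi Lf' Lr' Lpi' hD hf hr hp.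
  split.
  + apply lip_domain_downward with Lf Lr Lpi; trivial; lra.
  (* The reward term is the same on both sides; [0 <= eps_dyn] preserves the order of the
     coefficients. *)
  + apply Rplus_le_compat_l, Rmult_le_compat_r; trivial.
    now apply dyn_coef_le.
Qed.
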